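(* Let $n\ge 1$, $r\ge 2$, $s\ge 1$ be integers and $k=rs$. Let $G_{r,2s}(2n+1)$ be the graph with vertex set $\{u_i,v_i: 1\le i\le 2k\}\cup\{y_{b,j},z_{b,j}: 1\le b\le r,\ 1\le j\le 2n+1\}$ and edges: $u_iv_i$ for $1\le i\le 2k$; and, for each $1\le b\le r$, each $i\in\{(b-1)s+1,\dots,bs\}$ and each $1\le j\le 2n+1$, the edges $u_iy_{b,j}$, $v_{2k+1-i}y_{b,j}$, $v_iz_{b,j}$, $u_{2k+1-i}z_{b,j}$. Then $\chi_{la}(G_{r,2s}(2n+1))=3$.
   Context: For a graph $G$ with $q$ edges, a local antimagic labeling is a bijection $f:E(G)\to\{1,\dots,q\}$ such that, writing $f^+(u)=\sum_{e\ni u}f(e)$, we have $f^+(u)\ne f^+(v)$ for every edge $uv$. $\chi_{la}(G)$ is the minimum over all local antimagic labelings of the number of distinct values of $f^+$. *)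

(* Defs.v *)
From HB Require Import structures.
From mathcomp Require Import all_boot.

Set Implicit Arguments.
Unset Strict Implicit.
Unset Printing Implicit Defensive.

(* Simple graphs as sets of 2-element subsets of a finite vertex type;
   x and y are adjacent when [set x; y] \in edges G. *)
Record sgraph := SGraph {
  vertex :> finType;
  edges : {set {set vertex}};
  edges_card2 : forall e, e \in edges -> #|e| = 2
}.

Section LocalAntimagic.

Variable G : sgraph.

(* The labels 1, ..., q are the nonzero elements of 'I_q.+1. The values of a
   labeling on sets that are not edges are irrelevant. *)
Definition labeling := {ffun {set G} -> 'I_#|edges G|.+1}.

Definition vsum (f : labeling) (x : G) : nat :=
  \sum_(e in edges G | x \in e) f e.

Definition local_antimagic (f : labeling) : bool :=
  [&& dinjectiveb f (edges G),
      f @: edges G == [set l : 'I_#|edges G|.+1 | 0 < l]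
    & [forall x : G, forall y : G,
         ([set x; y] \in edges G) ==> (vsum f x != vsum f y)]].

Definition ncolors (f : labeling) : nat := size (undup (codom (vsum f))).

(* The default #|G|.+1 exceeds every ncolors f, so it is the value exactly
   when G has no local antimagic labeling. *)
Definition chi_la : nat :=
  \big[minn/#|G|.+1]_(f : labeling | local_antimagic f) ncolors f.

Lemma ncolors_le (f : labeling) : ncolors f <= #|G|.
Proof. by rewrite /ncolors (leq_trans (size_undup _)) // size_codom. Qed.

Lemma chi_la_le (f : labeling) : local_antimagic f -> chi_la <= ncolors f.
Proof.
move=> fP; rewrite /chi_la; have: f \in index_enum _ by rewrite mem_index_enum.
elim: (index_enum _) => // g t IH; rewrite inE big_cons.
case/orP=> [/eqP <-|/IH le_f]; first by rewrite fP geq_minl.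
by case: ifP => // _; rewrite (leq_trans (geq_minr _ _)).
Qed.

Lemma chi_la_attained :
  (exists f : labeling, local_antimagic f) <->
  (exists2 f : labeling, local_antimagic f & ncolors f = chi_la).
Proof.
split=> [[g gP]|[f fP _]]; last by exists f.
have: chi_la = #|G|.+1 \/
      exists2 f : labeling, local_antimagic f & ncolors f = chi_la.
  rewrite /chi_la; elim/big_ind: _; first by left.
    by move=> a b aP bP; case: (leqP a b).
  by move=> f fP; right; exists f.
case=> // chiE; have := leq_trans (chi_la_le gP) (ncolors_le g).
by rewrite chiE ltnn.
Qed.

End LocalAntimagic.

Section TheGraph.

Variables r s m : nat.

Local Notation k := (r * s).

(* u_i | v_i | y_{b,j} | z_{b,j}. All indices are shifted to start at 0, so
   that 2k+1-i becomes rev_ord i and (b-1)s+1 <= i <= bs becomes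
   b * s <= i < b.+1 * s. *)
Definition Gvertex : finType :=
  (('I_(2 * k) + 'I_(2 * k)) + ('I_r * 'I_m + 'I_r * 'I_m))%type.

Definition vu (i : 'I_(2 * k)) : Gvertex := inl (inl i).
Definition vv (i : 'I_(2 * k)) : Gvertex := inl (inr i).
Definition vy (b : 'I_r) (j : 'I_m) : Gvertex := inr (inl (b, j)).
Definition vz (b : 'I_r) (j : 'I_m) : Gvertex := inr (inr (b, j)).

Definition Gedges : {set {set Gvertex}} :=
  [set [set vu i; vv i] | i : 'I_(2 * k)] :|:
  \bigcup_(b < r) \bigcup_(i < 2 * k | b * s <= i < b.+1 * s) \bigcup_(j < m)
    [set [set vu i; vy b j]; [set vv (rev_ord i); vy b j];
         [set vv i; vz b j]; [set vu (rev_ord i); vz b j]].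

Lemma Gedges_card2 e : e \in Gedges -> #|e| = 2.
Proof.
rewrite inE => /orP[/imsetP[i _ ->]|]; first by rewrite cards2.
case/bigcupP=> b _ /bigcupP[i _ /bigcupP[j _]].
by rewrite !inE => /orP[/orP[/orP[]|]|] /eqP->; rewrite cards2.
Qed.

(* G_{r,2s}(m). *)
Definition Ggraph : sgraph := SGraph Gedges_card2.

End TheGraph.

(* Main.v *)
(* Lower bound: if only two values occurred, they would properly 2-color the
   graph. The involution exchanging u_i with v_i and y_{b,j} with z_{b,j}
   exchanges the two colors, so the classes have equal size; but each edge has
   one end in each class, so the classes also have equal total vertex sum, and
   the two values coincide.
   Upper bound: split the labels into 2m + 1 consecutive columns of length 2k
   (m = 2n + 1). Column 0 goes to the edges u_i v_i, columns 1, ..., m to the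
   edges at the u_i, and columns m + 1, ..., 2m to the edges at the v_i, the
   columns being traversed alternately upwards and downwards. As m + 1 is even,
   all u_i get the same sum; as the two edges from u_i and v_{2k+1-i} to a
   vertex y_{b,j} or z_{b,j} have labels adding up to 4k(m + 1) + 1, all v_i
   get the same sum too, and so do all y_{b,j} and z_{b,j}. *)
Require Import Defs.
From HB Require Import structures.
From mathcomp Require Import all_boot.
From mathcomp Require Import zify.

Set Implicit Arguments.
Unset Strict Implicit.
Unset Printing Implicit Defensive.

(** * Arbitrary graphs: forcing three colors by double counting *)

Lemma set2_neq (T : finType) (w : T -> nat) (x y a b : T) :
  [set x; y] = [set a; b] -> w a != w b -> w x != w y.
Proof.
move=> E; have [] : a \in [set x; y] /\ b \in [set x; y].
  by rewrite E !inE !eqxx orbT.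
by rewrite !inE => /orP[] /eqP -> /orP[] /eqP ->; rewrite ?eqxx // eq_sym.
Qed.

Section Graph.

Variable G : sgraph.
Implicit Type f : labeling G.

Lemma local_antimagic_neq f x y :
  local_antimagic f -> [set x; y] \in edges G -> vsum f x != vsum f y.
Proof. by case/and3P=> _ _ /forallP/(_ x)/forallP/(_ y)/implyP; apply. Qed.

Lemma ncolors_le2 f x y z : ncolors f <= 2 ->
  vsum f x != vsum f y -> vsum f y != vsum f z -> vsum f x = vsum f z.
Proof.
move=> f2 xy yz; apply: contraTeq f2 => xz; rewrite -ltnNge.
apply: (@uniq_leq_size _ [:: vsum f x; vsum f y; vsum f z]).
  by rewrite /= !inE negb_or xy xz yz.
by move=> c; rewrite !inE mem_undup => /or3P[] /eqP->; apply: codom_f.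
Qed.

(** Double counting of incidences: each edge contributes its label once for every end in [A]. *)
Lemma sum_vsum f (A : {set G}) :
  \sum_(x in A) vsum f x = \sum_(e in edges G) #|A :&: e| * f e.
Proof.
rewrite /vsum.
under eq_bigr do rewrite big_mkcondr.
rewrite exchange_big; apply: eq_bigr => e _ /=.
rewrite -big_mkcondr -sum1_card big_distrl /=.
by apply: eq_big => [x|x _]; rewrite ?inE ?mul1n.
Qed.

(** The hypothesis on [s] is conditional because for non-adjacent [x] and [s x] the separation is
    itself deduced from having only two colors. *)
Lemma ncolors_gt2 f (s : G -> G) (x0 : G) :
  local_antimagic f -> injective s ->
  (ncolors f <= 2 -> forall x, vsum f x != vsum f (s x)) -> 2 < ncolors f.
Proof.
move=> fP s_inj sP; rewrite ltnNge; apply/negP => f2.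
have {}sP := sP f2.
pose A := [set x | vsum f x == vsum f x0].
have vA x : x \in A -> vsum f x = vsum f x0 by rewrite inE => /eqP.
have vnA x : x \in ~: A -> vsum f x = vsum f (s x0).
  rewrite !inE => xA; apply: (ncolors_le2 f2 xA); exact: sP.
have sA x : (s x \in ~: A) = (x \in A).
  rewrite !inE; case: (eqVneq (vsum f x) (vsum f x0)) => [<-|xA].
    by rewrite eq_sym sP.
  apply/negbTE/negPn/eqP/esym/(@ncolors_le2 _ x0 x) => //.
  by rewrite eq_sym.
have cA : #|A| = #|~: A|.
  (* The injection [s] maps each class into the other, so neither class is larger. *)
  have half (B : {set G}) : s @: B \subset ~: B -> #|B| <= #|~: B|.
    by move=> /subset_leq_card; rewrite card_imset.
  apply/eqP; rewrite eqn_leq half /=; last first.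
    by apply/subsetP => _ /imsetP[x xA ->]; rewrite sA.
  have := half (~: A); rewrite setCK; apply.
  apply/subsetP => _ /imsetP[x xA ->].
  by rewrite -[_ \in A]negbK -in_setC sA -in_setC.
have eA : \sum_(x in A) vsum f x = \sum_(x in ~: A) vsum f x.
  rewrite !sum_vsum; apply: eq_bigr => e eE; congr (_ * _).
  have /eqP/cards2P[x [y [xy eE']]] := edges_card2 eE.
  have nxy : vsum f x != vsum f y.
    by apply: local_antimagic_neq => //; rewrite -eE'.
  suff yA : (y \in A) = (x \notin A).
    have I1 (B : {set G}) : #|B :&: e| = (x \in B) + (y \in B).
      rewrite -sum1_card big_mkcond (bigD1 x) //= (bigD1 y) //= 1?eq_sym //.
      rewrite big1 => [|z /andP[zx zy]].
        by rewrite eE' !inE !eqxx orbT !andbT addn0; do 2!case: (_ \in B).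
      by rewrite eE' !inE (negbTE zx) (negbTE zy) andbF.
    by rewrite !I1 !in_setC yA negbK addnC.
  rewrite !inE; move: nxy; case: (eqVneq (vsum f x) (vsum f x0)) => [->|xA nxy].
    by rewrite eq_sym => /negbTE.
  by apply/eqP/esym/(@ncolors_le2 _ x0 x) => //; rewrite eq_sym.
move: eA; rewrite (eq_bigr _ vA) (eq_bigr _ vnA) !sum_nat_const -cA.
move/eqP; rewrite eqn_pmul2l ?(negbTE (sP x0)) //.
by apply/card_gt0P; exists x0; rewrite inE.
Qed.

(** * Labelings from an enumeration of the edges *)

Variables (E : finType) (ed : E -> {set G}) (lab : E -> nat).
Hypotheses (ed_inj : injective ed) (ed_im : ed @: [set: E] = edges G).
Hypotheses (lab_inj : injective lab) (lab_bound : forall t, 0 < lab t <= #|E|).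

(** The value 0 is a default off the edges; on edges [lab_bound] makes [inord] exact. *)
Definition labeling_of : labeling G :=
  [ffun e => inord (if [pick t | ed t == e] is Some t then lab t else 0)].

Lemma edgesP e : e \in edges G -> exists t, e = ed t.
Proof. by rewrite -ed_im => /imsetP[t _ ->]; exists t. Qed.

Lemma card_edges : #|edges G| = #|E|.
Proof. by rewrite -ed_im card_imset // cardsT. Qed.

Lemma labeling_ofE t : labeling_of (ed t) = lab t :> nat.
Proof.
rewrite ffunE; case: pickP => [u /eqP/ed_inj->|/(_ t)]; last by rewrite eqxx.
by rewrite inordK // ltnS card_edges; case/andP: (lab_bound t).
Qed.

Lemma vsum_labeling_of x :
  vsum labeling_of x = \sum_(t | x \in ed t) lab t.
Proof.
rewrite /vsum; under eq_bigl do rewrite -ed_im.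
rewrite big_imset_cond /=; last by move=> ? ? _ _; apply: ed_inj.
by apply: eq_big => [t|t _]; rewrite ?inE // labeling_ofE.
Qed.

Lemma local_antimagic_labeling_of :
  (forall t, exists a b,
     ed t = [set a; b] /\ vsum labeling_of a != vsum labeling_of b) ->
  local_antimagic labeling_of.
Proof.
move=> edP; have inj : {in edges G &, injective labeling_of}.
  move=> e e' /edgesP[t ->] /edgesP[t' ->].
  by move/(congr1 val); rewrite /= !labeling_ofE => /lab_inj->.
apply/and3P; split.
- exact/dinjectiveP.
(* Surjectivity by counting: distinct positive labels, as many as there are edges. *)
- rewrite eqEcard; apply/andP; split.
    apply/subsetP => _ /imsetP[e /edgesP[t ->] ->].
    by rewrite inE labeling_ofE; case/andP: (lab_bound t).
  rewrite card_in_imset //.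
  have -> : [set l : 'I_#|edges G|.+1 | 0 < l] = ~: [set ord0].
    by apply/setP => l; rewrite !inE -val_eqE lt0n.
  by rewrite cardsC1 card_ord.
- apply/forallP => x; apply/forallP => y; apply/implyP.
  move=> /edgesP[t e]; have [a [b [e' ab]]] := edP t.
  by apply: set2_neq ab; rewrite e.
Qed.

End Graph.

(** * Blocks of indices and an enumeration of the edges *)

Section TheLabeling.

Variables r s m : nat.

Local Notation k := (r * s).
Local Notation V := (Gvertex r s m).

Lemma rev_ord_ltn_half (i : 'I_(2 * k)) : (rev_ord i < k) = ~~ (i < k).
Proof. by have := ltn_ord i; rewrite /=; lia. Qed.

Lemma block_size_gt0 (i : 'I_(2 * k)) : 0 < s.
Proof.
by case: i => i; rewrite lt0n; apply: contraTneq => ->; rewrite !muln0.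
Qed.

Lemma block_subproof (i : 'I_(2 * k)) : minn i (rev_ord i) %/ s < r.
Proof.
have := ltn_ord i; have s0 := block_size_gt0 i.
by rewrite ltn_divLR //=; lia.
Qed.

(** The minimum makes [block] invariant under [rev_ord], since [i] and [rev_ord i] are attached to
    vertices of the same block. It lies below [k], as the two indices add up to [2 * k - 1]. *)
Definition block (i : 'I_(2 * k)) : 'I_r := Ordinal (block_subproof i).

Lemma block_rev i : block (rev_ord i) = block i.
Proof.
by apply: val_inj; rewrite -[LHS]/(minn _ (rev_ord _) %/ s) rev_ordK minnC.
Qed.

(** Translates the index interval in the definition of the graph. Since [b.+1 * s <= k], that
    interval stays in the first half, where the minimum in [block] is [i] itself. *)
Lemma blockP (b : 'I_r) (i : 'I_(2 * k)) :
  (b * s <= i < b.+1 * s) = (i < k) && (block i == b).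
Proof.
have ltik := ltn_ord i; have s0 := block_size_gt0 i.
have [ik|ki] := ltnP i k => /=; last first.
  by apply/negbTE; have := leq_mul (ltn_ord b) (leqnn s); lia.
rewrite -val_eqE /= (minn_idPl _); last by lia.
by rewrite eqn_leq -leq_divRL // -ltn_divLR // ltnS andbC.
Qed.

Lemma card_block (b : 'I_r) :
  #|[pred i : 'I_(2 * k) | (i < k) && (block i == b)]| = s.
Proof.
have le_bk : b.+1 * s <= 2 * k.
  by have := leq_mul (ltn_ord b) (leqnn s); lia.
rewrite -sum1_card; under eq_bigl do rewrite inE -blockP.
rewrite -(big_mkord (fun i => b * s <= i < b.+1 * s) (fun=> 1)).
transitivity (\sum_(b * s <= i < b.+1 * s) 1).
  rewrite (big_nat_widen _ _ _ _ _ le_bk) (@big_nat_widenl _ _ _ (b * s) 0) //.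
  by apply: eq_bigl => i; rewrite andbC.
by rewrite sum_nat_const_nat muln1; lia.
Qed.

(** Edges are indexed by their end among the [u] and [v], with [i] running over both halves, so that
    each edge occurs once: first the edges joining [u] to [v], then the others at [u], then the
    others at [v]. *)
Definition edge_index : finType :=
  ('I_(2 * k) + ('I_m * 'I_(2 * k) + 'I_m * 'I_(2 * k)))%type.

Definition u_nbr (j : 'I_m) (i : 'I_(2 * k)) : V :=
  if i < k then vy _ (block i) j else vz _ (block i) j.

Definition v_nbr (j : 'I_m) (i : 'I_(2 * k)) : V :=
  if i < k then vz _ (block i) j else vy _ (block i) j.

Definition edge_of (t : edge_index) : {set V} :=
  match t with
  | inl i => [set vu _ i; vv _ i]
  | inr (inl (j, i)) => [set vu _ i; u_nbr j i]
  | inr (inr (j, i)) => [set vv _ i; v_nbr j i]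
  end.

(** The kinds of the two ends give the summand of the index; the end among the [u] and [v] gives
    [i], and the other end gives [j]. *)
Lemma edge_of_inj : injective edge_of.
Proof.
have set2_eq (a b c d : V) :
    [set a; b] = [set c; d] -> a = c /\ b = d \/ a = d /\ b = c.
  move=> E; move: (set21 a b) (set22 a b); rewrite E => A B.
  move: (set22 c d) (set21 c d) A B; rewrite -{1 2}E !inE.
  move=> D C /orP[]/eqP A /orP[]/eqP B; subst; auto.
    by move: D; rewrite orbb => /eqP ->; auto.
  by move: C; rewrite orbb => /eqP ->; auto.
have nbr_inj (y z : 'I_m -> V) (c : bool) j j' : injective y -> injective z ->
    (if c then y j else z j) = (if c then y j' else z j') -> j = j'.
  by move=> yI zI; case: c => [/yI|/zI].
move=> [i|[[j i]|[j i]]] [i'|[[j' i']|[j' i']]] /= /set2_eq[[]|[]] //;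
  rewrite /u_nbr /v_nbr; do ?[by case: ifP | by move=> ?; case: ifP].
- by case=> ->.
- by case=> <- /nbr_inj -> // ? ? [].
- by case=> <- /nbr_inj -> // ? ? [].
Qed.

Lemma edge_of_im : edge_of @: [set: edge_index] = Gedges r s m.
Proof.
apply/setP => e; apply/imsetP/idP => [[t _ ->]|].
  have bl i j e' : e' \in [set [set vu m i; vy s (block i) j];
      [set vv m (rev_ord i); vy s (block i) j]; [set vv m i; vz s (block i) j];
      [set vu m (rev_ord i); vz s (block i) j]] -> i < k -> e' \in Gedges r s m.
    move=> e'P ik; apply/setUP; right; apply/bigcupP; exists (block i) => //.
    apply/bigcupP; exists i; first by rewrite blockP ik eqxx.
    by apply/bigcupP; exists j.
  case: t => [i|[[j i]|[j i]]] /=.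
  - by apply/setUP; left; apply: imset_f.
  - rewrite /u_nbr; case: ifP => ik.
      by apply: (bl i j); rewrite ?inE ?eqxx.
    (* [Gedges] lists this edge under the mirror index, which lies in the first half. *)
    apply: (bl (rev_ord i) j); last by rewrite rev_ord_ltn_half ik.
    by rewrite rev_ordK block_rev !inE eqxx !orbT.
  - rewrite /v_nbr; case: ifP => ik.
      by apply: (bl i j); rewrite ?inE ?eqxx ?orbT.
    apply: (bl (rev_ord i) j); last by rewrite rev_ord_ltn_half ik.
    by rewrite rev_ordK block_rev !inE eqxx !orbT.
rewrite inE => /orP[/imsetP[i _ ->]|]; first by exists (inl i).
case/bigcupP=> b _ /bigcupP[i]; rewrite blockP => /andP[ik /eqP<-].
case/bigcupP=> j _.
have rik : (rev_ord i < k) = false by rewrite rev_ord_ltn_half ik.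
rewrite !inE => /orP[/orP[/orP[]|]|] /eqP->.
- by exists (inr (inl (j, i))); rewrite ?inE //= /u_nbr ik.
- by exists (inr (inr (j, rev_ord i))); rewrite ?inE //= /v_nbr rik block_rev.
- by exists (inr (inr (j, i))); rewrite ?inE //= /v_nbr ik.
- by exists (inr (inl (j, rev_ord i))); rewrite ?inE //= /u_nbr rik block_rev.
Qed.

(** * The labeling by columns *)

Definition pos (j : nat) (i : 'I_(2 * k)) : 'I_(2 * k) :=
  if odd j then i else rev_ord i.

Definition column (t : edge_index) : nat :=
  match t with
  | inl _ => 0
  | inr (inl (j, _)) => j.+1
  | inr (inr (j, _)) => 2 * m - j
  end.

Definition position (t : edge_index) : 'I_(2 * k) :=
  match t with
  | inl i => i
  | inr (inl (j, i)) | inr (inr (j, i)) => pos j i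
  end.

Definition label (t : edge_index) : nat := 2 * k * column t + (position t).+1.
Definition label_u j i := label (inr (inl (j, i))).
Definition label_v j i := label (inr (inr (j, i))).

(** The two columns add up to [2 * m + 1]. Both are traversed in the same direction, so opposite
    positions, counted from 1, add up to [2 * k + 1]. *)
Lemma label_uv j i : label_u j i + label_v j (rev_ord i) = 4 * k * m.+1 + 1.
Proof.
have E : pos j (rev_ord i) = rev_ord (pos j i).
  by rewrite /pos; case: odd.
have := ltn_ord (pos j i).
rewrite /label_u /label_v /label /= E addnACA -mulnDr /=.
have -> : j.+1 + (2 * m - j) = 2 * m + 1 by have := ltn_ord j; lia.
by lia.
Qed.

Lemma pos_inj j : injective (pos j).
Proof. by rewrite /pos => i i'; case: odd => // /rev_ord_inj. Qed.

(** Uniqueness of division with remainder: a label determines its column and position. *)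
Lemma divmod_ord_inj (d a b : nat) (i i' : 'I_d) :
  d * a + i.+1 = d * b + i'.+1 -> a = b /\ i = i'.
Proof.
rewrite !addnS => -[E]; have d0 : 0 < d by apply: leq_ltn_trans (ltn_ord i).
have := congr1 (divn^~ d) E; have := congr1 (modn^~ d) E.
rewrite !(mulnC d) !modnMDl !divnMDl // !modn_small // !divn_small // !addn0.
by move=> /val_inj.
Qed.

Lemma label_inj : injective label.
Proof.
have lt j := ltn_ord (j : 'I_m).
move=> t t' /divmod_ord_inj[].
case: t t' => [i|[[j i]|[j i]]] [i'|[[j' i']|[j' i']]] //=.
- by move=> _ ->.
- by have := lt j'; lia.
- by move=> [/val_inj<-] /pos_inj<-.
- by have := lt j; have := lt j'; lia.
- by have := lt j; lia.
- by have := lt j; have := lt j'; lia.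
- move=> jj'; have {jj'}<- : j = j'.
    by apply: val_inj; have := lt j; have := lt j'; move: jj' => /=; lia.
  by move=> /pos_inj<-.
Qed.

Lemma label_bound t : 0 < label t <= #|edge_index|.
Proof.
have c2m : column t <= 2 * m.
  by case: t => [i|[[j i]|[j i]]] /=; try have := ltn_ord j; lia.
rewrite !card_sum !card_prod !card_ord /label.
by have := leq_mul (leqnn (2 * k)) c2m; have := ltn_ord (position t); lia.
Qed.

(** * Vertex sums of the labeling *)

Lemma sum_edge_index (P : pred edge_index) (F : edge_index -> nat) :
  \sum_(t | P t) F t = \sum_(i | P (inl i)) F (inl i)
   + (\sum_j \sum_(i | P (inr (inl (j, i)))) F (inr (inl (j, i)))
    + \sum_j \sum_(i | P (inr (inr (j, i)))) F (inr (inr (j, i)))).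
Proof.
rewrite big_sumType big_sumType /=; congr (_ + (_ + _)).
  by rewrite pair_big_dep; apply: eq_big => -[].
by rewrite pair_big_dep; apply: eq_big => -[].
Qed.

Lemma vu_u_nbr (i i' : 'I_(2 * k)) j : (vu m i == u_nbr j i') = false.
Proof. by rewrite /u_nbr; case: ifP. Qed.

Lemma vu_v_nbr (i i' : 'I_(2 * k)) j : (vu m i == v_nbr j i') = false.
Proof. by rewrite /v_nbr; case: ifP. Qed.

Lemma vv_u_nbr (i i' : 'I_(2 * k)) j : (vv m i == u_nbr j i') = false.
Proof. by rewrite /u_nbr; case: ifP. Qed.

Lemma vv_v_nbr (i i' : 'I_(2 * k)) j : (vv m i == v_nbr j i') = false.
Proof. by rewrite /v_nbr; case: ifP. Qed.

Lemma vy_u_nbr b j j' i :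
  (vy s b j == u_nbr j' i) = (j' == j) && ((i < k) && (block i == b)).
Proof.
rewrite /u_nbr; case: ifP => _; last by rewrite andbF.
by rewrite -[LHS]/((b, j) == (block i, j')) xpair_eqE eq_sym andbC (eq_sym j).
Qed.

Lemma vy_v_nbr b j j' i :
  (vy s b j == v_nbr j' i) = (j' == j) && (~~ (i < k) && (block i == b)).
Proof.
rewrite /v_nbr; case: ifP => _; first by rewrite andbF.
by rewrite -[LHS]/((b, j) == (block i, j')) xpair_eqE eq_sym andbC (eq_sym j).
Qed.

Lemma vz_u_nbr b j j' i :
  (vz s b j == u_nbr j' i) = (j' == j) && (~~ (i < k) && (block i == b)).
Proof.
rewrite /u_nbr; case: ifP => _; first by rewrite andbF.
by rewrite -[LHS]/((b, j) == (block i, j')) xpair_eqE eq_sym andbC (eq_sym j).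
Qed.

Lemma vz_v_nbr b j j' i :
  (vz s b j == v_nbr j' i) = (j' == j) && ((i < k) && (block i == b)).
Proof.
rewrite /v_nbr; case: ifP => _; last by rewrite andbF.
by rewrite -[LHS]/((b, j) == (block i, j')) xpair_eqE eq_sym andbC (eq_sym j).
Qed.

Lemma sum_label_u i :
  \sum_(t | vu m i \in edge_of t) label t = i.+1 + \sum_(j < m) label_u j i.
Proof.
rewrite sum_edge_index; congr (_ + _).
  rewrite (big_pred1 i) => [|i']; first by rewrite /label muln0.
  by rewrite !inE orbF eq_sym.
rewrite [X in _ + X]big1 ?addn0 => [|j _]; last first.
  by rewrite big_pred0 // => i'; rewrite !inE vu_v_nbr orbF.
apply: eq_bigr => j _; rewrite (big_pred1 i) // => i'.
by rewrite !inE vu_u_nbr orbF eq_sym.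
Qed.

Lemma sum_label_v i :
  \sum_(t | vv m i \in edge_of t) label t = i.+1 + \sum_(j < m) label_v j i.
Proof.
rewrite sum_edge_index; congr (_ + _).
  rewrite (big_pred1 i) => [|i']; first by rewrite /label muln0.
  by rewrite !inE /= eq_sym.
rewrite big1 ?add0n => [|j _]; last first.
  by rewrite big_pred0 // => i'; rewrite !inE vv_u_nbr orbF.
apply: eq_bigr => j _; rewrite (big_pred1 i) // => i'.
by rewrite !inE vv_v_nbr orbF eq_sym.
Qed.

Lemma sum_slice (j : 'I_m) (P : pred 'I_(2 * k))
    (F : 'I_m -> 'I_(2 * k) -> nat) :
  \sum_j' \sum_(i | (j' == j) && P i) F j' i = \sum_(i | P i) F j i.
Proof.
rewrite (bigD1 j) //= [X in _ + X]big1 ?addn0 => [|j' /negbTE j'j].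
  by apply: eq_bigl => i; rewrite eqxx.
by rewrite big_pred0 // => i; rewrite j'j.
Qed.

(** Reversal matches the second half of block [b] with its [s] indices in the first half, giving [s]
    pairs of sum [c]. For [y], [F] and [H] are the labels at [u] and at [v]; for [z] they are
    exchanged. *)
Lemma sum_block (b : 'I_r) (F H : 'I_(2 * k) -> nat) c :
  (forall i, F i + H (rev_ord i) = c) ->
  \sum_(i < 2 * k | (i < k) && (block i == b)) F i
   + \sum_(i < 2 * k | ~~ (i < k) && (block i == b)) H i = s * c.
Proof.
move=> FH; rewrite [X in _ + X](reindex_inj rev_ord_inj).
have revE (i : 'I_(2 * k)) : ~~ (rev_ord i < k) && (block (rev_ord i) == b)
    = (i < k) && (block i == b).
  by rewrite block_rev rev_ord_ltn_half negbK.
rewrite [X in _ + X](eq_bigl _ _ revE).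
rewrite -big_split /=; under eq_bigr do rewrite FH.
by rewrite sum_nat_const card_block.
Qed.

Lemma sum_label_y b j :
  \sum_(t | vy s b j \in edge_of t) label t = s * (4 * k * m.+1 + 1).
Proof.
rewrite sum_edge_index /= big_pred0 ?add0n => [|i]; last by rewrite !inE.
rewrite -(@sum_block b (label_u j) (label_v j)); last exact: label_uv.
rewrite -!sum_slice; congr (_ + _); apply: eq_bigr => j' _; apply: eq_bigl => i.
  by rewrite !inE /= vy_u_nbr.
by rewrite !inE /= vy_v_nbr.
Qed.

Lemma sum_label_z b j :
  \sum_(t | vz s b j \in edge_of t) label t = s * (4 * k * m.+1 + 1).
Proof.
rewrite sum_edge_index /= big_pred0 ?add0n => [|i]; last by rewrite !inE.
rewrite addnC -(@sum_block b (label_v j) (label_u j)); last first.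
  by move=> i; rewrite addnC -{2}[i]rev_ordK label_uv.
rewrite -!sum_slice; congr (_ + _); apply: eq_bigr => j' _; apply: eq_bigl => i.
  by rewrite !inE /= vz_v_nbr.
by rewrite !inE /= vz_u_nbr.
Qed.

(** * At least three colors on the graph *)

Lemma edge_of_edges t : edge_of t \in edges (Ggraph r s m).
Proof. by rewrite /= -edge_of_im imset_f. Qed.

Definition swap (x : Ggraph r s m) : Ggraph r s m :=
  match x with
  | inl (inl i) => vv m i
  | inl (inr i) => vu m i
  | inr (inl (b, j)) => vz s b j
  | inr (inr (b, j)) => vy s b j
  end.

Lemma swapK : involutive swap.
Proof. by case=> [[]|[[]|[]]]. Qed.

Lemma ncolors_Ggraph_gt2 (f : labeling (Ggraph r s m)) :
  0 < k -> local_antimagic f -> 2 < ncolors f.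
Proof.
move=> k0 fP; have s0 : 0 < s by case/andP: (etrans (esym (muln_gt0 _ _)) k0).
have lt0 : 0 < 2 * k by rewrite muln_gt0.
apply: (@ncolors_gt2 _ _ swap (vu m (Ordinal lt0))) => //.
  exact: inv_inj swapK.
move=> f2.
have uv (i : 'I_(2 * k)) : vsum f (vu m i) != vsum f (vv m i).
  exact/(local_antimagic_neq fP)/(edge_of_edges (inl i)).
have yz (b : 'I_r) (j : 'I_m) : vsum f (vy s b j) != vsum f (vz s b j).
  (* The path [y], [u], [v], [z] through the first index [b * s] of the block: with two colors, [y]
     is colored like [v], hence unlike [z]. *)
  have lt_bk : b * s < 2 * k by have := leq_mul (ltn_ord b) (leqnn s); lia.
  have := blockP b (Ordinal lt_bk).
  rewrite /= leqnn mulSn -{1}[b * s]add0n ltn_add2r s0.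
  move=> /esym/andP[ik /eqP ib].
  have uy := edge_of_edges (inr (inl (j, Ordinal lt_bk))).
  have vz := edge_of_edges (inr (inr (j, Ordinal lt_bk))).
  move: uy vz; rewrite /= /u_nbr /v_nbr ik ib.
  move=> /(local_antimagic_neq fP) uy /(local_antimagic_neq fP) vz.
  rewrite (ncolors_le2 f2 _ (uv (Ordinal lt_bk))) //.
  by rewrite eq_sym.
case=> [[i|i]|[[b j]|[b j]]].
- exact: uv.
- by rewrite eq_sym; apply: uv.
- exact: yz.
- by rewrite eq_sym; apply: yz.
Qed.

End TheLabeling.

(** * Arithmetic of the three colors and conclusion *)

Lemma sum_alternating (n N a c : nat) : a + c.+1 = N ->
  a.+1 + \sum_(j < 2 * n + 1) (N * j.+1 + (if odd j then a else c).+1)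
  = n.+1 * (2 * N * n.+1 + 1).
Proof.
(* Each induction step adds one column of either direction, whose positions add up to [N + 1]. *)
move=> <-; elim: n => [|n IH]; first by rewrite big_ord_recr big_ord0 /=; lia.
have -> : 2 * n.+1 + 1 = (2 * n + 1).+2 by lia.
rewrite !big_ord_recr /= !addnA IH.
have -> : odd (2 * n + 1) by rewrite addn1 /= mul2n odd_double.
by rewrite /=; lia.
Qed.

(* A, B and C are the common values of vsum on the u_i, on the v_i, and on the
   y_{b,j} and z_{b,j}. *)
Lemma colors_distinct (k s M A B C : nat) :
  0 < M -> 0 < s -> s <= k ->
  A = M * (4 * k * M + 1) ->
  A + B = 2 * k + 1 + (2 * M - 1) * (8 * k * M + 1) ->
  C = s * (8 * k * M + 1) ->
  [/\ A != B, A != C & B != C].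
Proof.
move=> M0 s0 sk eA eAB eC.
have kM : 8 * k * M <= 8 * k * M * M by rewrite leq_pmulr.
have ABE : A + B = 2 * k + 16 * k * M * M + 2 * M - 8 * k * M.
  by rewrite eAB mulnBl mul1n; lia.
split; apply/eqP => E.
- by lia.
(* The leading terms of [A] and [C] are [4 * k * M * M] and [8 * k * s * M], which balance at
   [M = 2 * s]. *)
- have [Ms|sM] := leqP (2 * s) M.
    by have := leq_mul (leqnn (4 * k * M)) Ms; lia.
  by have := leq_mul (leqnn (4 * k * M)) sM; nia.
(* Here [B = 12 * k * M * M - 8 * k * M + 2 * k + M]; its first two terms balance [8 * k * s * M] at
   [3 * M = 2 * s + 2]. *)
- have [Ms|sM] := leqP (2 * s + 2) (3 * M).
    by have := leq_mul (leqnn (4 * k * M)) Ms; lia.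
  have := leq_mul (leqnn (4 * k * M)) sM.
  by have := leq_mul (leqnn (4 * k)) M0; lia.
Qed.

Theorem theorem3p4 (n r s : nat) (hn : 1 <= n) (hr : 2 <= r) (hs : 1 <= s) :
  chi_la (Ggraph r s (2 * n + 1)) = 3.
Proof.
set m := 2 * n + 1; set G := Ggraph r s m.
have k0 : 0 < r * s by rewrite muln_gt0 hs (ltnW hr).
pose f := @labeling_of G _ (@edge_of r s m) (@label r s m).
have fE := @vsum_labeling_of G _ _ _
  (@edge_of_inj r s m) (edge_of_im r s m) (@label_bound r s m).
pose A := n.+1 * (4 * (r * s) * n.+1 + 1).
pose C := s * (4 * (r * s) * m.+1 + 1).
have fu i : vsum f (vu m i) = A.
  rewrite fE sum_label_u.
  transitivity (n.+1 * (2 * (2 * (r * s)) * n.+1 + 1)); last by rewrite /A; lia.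
  rewrite -(@sum_alternating n _ i (rev_ord i)); last first.
    by have := ltn_ord i; rewrite /=; lia.
  congr (_ + _); apply: eq_bigr => j _; rewrite /label_u /label /= /pos.
  by case: odd.
have fuv i : vsum f (vu m (rev_ord i)) + vsum f (vv m i)
    = 2 * (r * s) + 1 + m * (4 * (r * s) * m.+1 + 1).
  rewrite !fE sum_label_u sum_label_v addnACA -big_split /=.
  under eq_bigr do rewrite -{2}[i]rev_ordK label_uv.
  rewrite sum_nat_const card_ord; congr (_ + _).
  by have := ltn_ord i; lia.
have i0 : 'I_(2 * (r * s)) by apply: (@Ordinal _ 0); rewrite muln_gt0.
pose B := vsum f (vv m i0).
(* All [u] sums are [A], so cancelling in [fuv] makes the [v] sums constant. *)
have fv i : vsum f (vv m i) = B.
  by apply: (@addnI A); rewrite -{1}(fu (rev_ord i)) fuv -(fu (rev_ord i0)) fuv.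
have fy b j : vsum f (vy s b j) = C by rewrite fE sum_label_y.
have fz b j : vsum f (vz s b j) = C by rewrite fE sum_label_z.
have [AB AC BC] : [/\ A != B, A != C & B != C].
  (* With [M = n.+1] one has [m = 2 * M - 1] and [m.+1 = 2 * M]. *)
  apply: (@colors_distinct (r * s) s n.+1) => //.
    by rewrite leq_pmull ?(ltnW hr).
    by rewrite -(fu (rev_ord i0)) fuv; congr (_ + _ * (_ + _)); rewrite /m; lia.
  by rewrite /C /m; lia.
have fP : local_antimagic f.
  apply: local_antimagic_labeling_of.
  - exact: edge_of_inj.
  - exact: edge_of_im.
  - exact: label_inj.
  - exact: label_bound.
  case=> [i|[[j i]|[j i]]] /=; do 2!eexists; (split; first by []).
  - by rewrite fu fv.
  - by rewrite /u_nbr fu; case: ifP; rewrite ?fy ?fz.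
  - by rewrite /v_nbr fv; case: ifP; rewrite ?fy ?fz.
have f3 : ncolors f <= 3.
  apply: (@leq_trans (size [:: A; B; C])) => //.
  apply: uniq_leq_size (undup_uniq _) _ => c.
  rewrite mem_undup => /codomP[[[i|i]|[[b j]|[b j]]] ->].
  - by rewrite fu !inE eqxx.
  - by rewrite fv !inE eqxx orbT.
  - by rewrite fy !inE eqxx !orbT.
  - by rewrite fz !inE eqxx !orbT.
apply/eqP; rewrite eqn_leq (leq_trans (chi_la_le fP)) //=.
have [g gP <-] := (chi_la_attained G).1 (ex_intro _ f fP).
exact: ncolors_Ggraph_gt2.
Qed.
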